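(* Let $n\ge m\ge1$ and let $A$ be a complex $m\times n$ matrix. If $1\le p\le q$, then $$m^{-1/p}\|A\|_{S_p}\le m^{-1/q}\|A\|_{S_q}.$$ Equality holds if and only if the rows of $A$ are pairwise orthogonal vectors of equal length.
   Context: For an $m\times n$ complex matrix $A$, $\sigma_1(A)\ge\cdots\ge\sigma_m(A)$ are its singular values (square roots of the eigenvalues of $AA^*$, where $A^*$ is the Hermitian adjoint of $A$), and for real $p\ge1$, $\|A\|_{S_p}=\left(\sigma_1^p(A)+\cdots+\sigma_m^p(A)\right)^{1/p}$ is the Schatten $p$-norm. Length of a vector means Euclidean norm, and orthogonality is with respect to the standard Hermitian inner product.
   Formalization: The equality characterization is stated only for p < q: when p = q both sides coincide for every A, so ''only if'' fails (e.g. m = n = 2, A = diag(1,0)); the inequality is stated for all 1 ≤ p ≤ q. *)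

(* Defs.v *)
From HB Require Import structures.
From mathcomp Require Import all_boot all_order all_algebra.
From mathcomp Require Import sesquilinear spectral complex.
From mathcomp Require Import reals exp.

Set Implicit Arguments.
Unset Strict Implicit.
Unset Printing Implicit Defensive.

Import Order.TTheory GRing.Theory Num.Theory.
Local Open Scope ring_scope.
Local Open Scope complex_scope.
Local Open Scope sesquilinear_scope.

(* Eigenvalues with algebraic multiplicity (n of them), in unspecified order. *)
Definition eigenvalues (C : numClosedFieldType) (n : nat) (M : 'M[C]_n) :
  seq C := sval (closed_field_poly_normal (char_poly M)).

(* A A^* is positive semidefinite, so complex.Re only recasts its eigenvalues
   (real and nonnegative elements of R[i]) as elements of R. *)
Definition singular_values (R : realType) (m n : nat) (A : 'M[R[i]]_(m, n)) :
  seq R :=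
  sort >=%R [seq Num.sqrt (complex.Re z) | z <- eigenvalues (A *m A ^t*)].

(* Indexed from 0: singular_value A i is sigma_(i+1)(A). *)
Definition singular_value (R : realType) (m n : nat) (A : 'M[R[i]]_(m, n))
  (i : nat) : R := (singular_values A)`_i.

Definition schatten (R : realType) (p : R) (m n : nat) (A : 'M[R[i]]_(m, n)) :
  R := (\sum_(i < m) singular_value A i `^ p) `^ p^-1.

(* As usual in R[i], the length is a nonnegative real element of R[i]. *)
Definition length (C : numClosedFieldType) (n : nat) (u : 'rV[C]_n) : C :=
  sqrtC (dotmx u u).

Definition rows_pairwise_orthogonal (C : numClosedFieldType) (m n : nat)
  (A : 'M[C]_(m, n)) : Prop :=
  forall i j : 'I_m, i != j -> dotmx (row i A) (row j A) = 0.

Definition rows_equal_length (C : numClosedFieldType) (m n : nat)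
  (A : 'M[C]_(m, n)) : Prop :=
  forall i j : 'I_m, length (row i A) = length (row j A).

(* Main.v *)
(* With s_i the singular values of A, both sides are power means of
   (s_1, .., s_m), so the inequality is the power mean inequality, obtained
   from the tangent line bound 1 + r (t - 1) <= t ^ r (r = q / p) at
   t = s_i ^ p / M, where M is the mean of the s_j ^ p.  The bound is strict
   away from t = 1, so equality for p < q forces all s_i to coincide.  Since
   A A^* is unitarily diagonalizable with eigenvalues s_i ^ 2, this means that
   A A^*, the Gram matrix of the rows of A, is a scalar matrix. *)
Require Import Defs.
From mathcomp Require Import all_boot all_order all_algebra.
From mathcomp Require Import sesquilinear spectral.
From mathcomp Require Import complex.
From mathcomp Require Import reals sequences exp.
From mathcomp Require Import ring lra.

Import Order.TTheory GRing.Theory Num.Theory.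
Local Open Scope ring_scope.
Local Open Scope complex_scope.
Local Open Scope sesquilinear_scope.

Set Implicit Arguments.
Unset Strict Implicit.
Unset Printing Implicit Defensive.

(** Follows from [1 + x < exp x] for nonzero [x], used at [x = (r - 1) ln t] and at [x = - ln t]. At
    [t = 0], treated apart, it reads [1 - r < 0]. *)
Lemma powR_gt_tangent (R : realType) (r t : R) :
  1 < r -> 0 <= t -> t != 1 -> 1 + r * (t - 1) < t `^ r.
Proof.
move=> r1; rewrite le_eqVlt => /predU1P[<- _|t0 t1].
  by rewrite powR0 ?gt_eqF ?(lt_trans ltr01 r1)//; lra.
have b0 : ln t != 0 by rewrite ln_eq0.
have rb0 : (r - 1) * ln t != 0 by rewrite mulf_neq0 ?subr_eq0 ?(gt_eqF r1).
have nb0 : - ln t != 0 by rewrite oppr_eq0.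
have := expR_gt1Dx nb0; have := expR_gt1Dx rb0.
have -> : t `^ r = t * expR ((r - 1) * ln t).
  rewrite -[t in t * _](lnK t0) -expRD /powR gt_eqF//.
  by rewrite mulrBl mul1r addrC subrK.
have : t * expR (- ln t) = 1 by rewrite expRN lnK// mulfV ?gt_eqF.
move: (expR (- ln t)) (expR ((r - 1) * ln t)) => v w.
move: (ln t) => b tv h1 h2.
(* With b = ln t, w = t ^ (r - 1), v = 1 / t:
   t (w + (r - 1) v) > t (1 + (r - 1) b + (r - 1) (1 - b)) = r t *)
have h3 : r < w + (r - 1) * v.
  have : (r - 1) * (1 - b) < (r - 1) * v by rewrite ltr_pM2l ?subr_gt0.
  lra.
have : t * r < t * (w + (r - 1) * v) by rewrite ltr_pM2l.
have -> : t * (w + (r - 1) * v) = t * w + (r - 1) * (t * v) by ring.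
rewrite tv; lra.
Qed.

Lemma powR_ge_tangent (R : realType) (r t : R) :
  1 <= r -> 0 <= t -> 1 + r * (t - 1) <= t `^ r.
Proof.
rewrite le_eqVlt => /predU1P[<- t0|r1 t0].
  by rewrite powRr1//; lra.
have [->|t1] := eqVneq t 1; last exact/ltW/powR_gt_tangent.
by rewrite powR1 subrr mulr0 addr0.
Qed.

Section PowerMean.
Variables (R : realType) (m : nat) (x : 'I_m -> R).
Hypotheses (m0 : (0 < m)%N) (x0 : forall i, 0 <= x i).

Let mean := m%:R^-1 * \sum_i x i.

Let mR0 : (0 : R) < m%:R. Proof. by rewrite ltr0n. Qed.

Let mean_ge0 : 0 <= mean.
Proof. by rewrite mulr_ge0 ?invr_ge0 ?ler0n ?sumr_ge0. Qed.

Let mean_eq0 : mean = 0 -> forall i, x i = 0.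
Proof.
move/eqP; rewrite mulf_eq0 invr_eq0 gt_eqF//= => /eqP s0 i.
exact: (psumr_eq0P _ s0).
Qed.

(** The linear terms cancel: the relative deviations [x i / mean - 1] sum to zero. *)
Let sum_tangent r : mean != 0 ->
  \sum_i mean `^ r * (1 + r * (x i / mean - 1)) = m%:R * mean `^ r.
Proof.
move=> M0; rewrite -mulr_sumr mulrC; congr (_ * _).
rewrite big_split/= sumr_const card_ord -mulr_sumr sumrB sumr_const card_ord.
rewrite -mulr_suml.
have -> : \sum_i x i = m%:R * mean by rewrite mulrA mulfV ?mul1r// gt_eqF.
by rewrite mulfK// subrr mulr0 addr0.
Qed.

Let scale r i : mean != 0 -> x i `^ r = mean `^ r * (x i / mean) `^ r.
Proof.
move=> M0; rewrite -powRM ?divr_ge0//.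
by rewrite mulrCA mulfV ?mulr1.
Qed.

Lemma powR_mean_le r : 1 <= r ->
  mean `^ r <= m%:R^-1 * \sum_i x i `^ r.
Proof.
(* The tangent bound is taken at [x i / mean]; for a zero mean the left side is simply 0. *)
move=> r1; have [M0|M0] := eqVneq mean 0.
  rewrite M0 powR0 ?gt_eqF ?(lt_le_trans ltr01)//.
  by rewrite mulr_ge0 ?invr_ge0 ?ler0n ?sumr_ge0// => i _; exact: powR_ge0.
rewrite ler_pdivlMl// -sum_tangent//; apply: ler_sum => i _.
by rewrite scale// ler_wpM2l ?powR_ge0// powR_ge_tangent ?divr_ge0.
Qed.

Lemma powR_mean_eq r : 1 < r ->
  mean `^ r = m%:R^-1 * \sum_i x i `^ r -> forall i, x i = mean.
Proof.
move=> r1 E i; have [M0|M0] := eqVneq mean 0; first by rewrite M0 mean_eq0.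
have Mr0 : 0 < mean `^ r by rewrite powR_gt0// lt_neqAle eq_sym M0 mean_ge0.
have le_tan j : mean `^ r * (1 + r * (x j / mean - 1)) <= x j `^ r.
  by rewrite scale// ler_pM2l// powR_ge_tangent ?divr_ge0// ltW.
(* Under equality the nonnegative gaps above the tangent sum to zero, so each vanishes; a ratio
   [x i / mean] other than 1 would leave a positive gap. *)
have S : \sum_j (x j `^ r - mean `^ r * (1 + r * (x j / mean - 1))) = 0.
  by rewrite sumrB sum_tangent// E mulrA mulfV ?mul1r ?subrr// gt_eqF.
have xM : x i / mean = 1.
  apply/eqP/negPn/negP => /(powR_gt_tangent r1 (divr_ge0 (x0 i) mean_ge0)).
  rewrite -(ltr_pM2l Mr0) -scale// -subr_gt0 (psumr_eq0P _ S) ?ltxx// => j _.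
  by rewrite subr_ge0.
by rewrite -[LHS](divfK M0) xM mul1r.
Qed.

End PowerMean.

Section Eigenvalues.
Variables (C : numClosedFieldType) (n : nat) (M : 'M[C]_n).

Let char_poly_eigenvalues :
  char_poly M = \prod_(z <- eigenvalues M) ('X - z%:P).
Proof.
rewrite /eigenvalues; case: closed_field_poly_normal => s /= ->.
by rewrite (monicP (char_poly_monic M)) scale1r.
Qed.

(** By degree count. Thus no singular value of index below [m] is the default of [nth]. *)
Lemma size_eigenvalues : size (eigenvalues M) = n.
Proof.
by apply: succn_inj; rewrite -(size_prod_XsubC _ id) -char_poly_eigenvalues
  size_char_poly.
Qed.

Lemma mem_eigenvalues z : (z \in eigenvalues M) = eigenvalue M z.
Proof.
by rewrite eigenvalue_root_char char_poly_eigenvalues root_prod_XsubC.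
Qed.

End Eigenvalues.

Section Gram.
Variables (C : numClosedFieldType) (m n : nat) (A : 'M[C]_(m, n)).

Lemma mulmx_adjoint_dotmx i j :
  (A *m A ^t*) i j = dotmx (row i A) (row j A).
Proof. by rewrite dotmxE !mxE; apply: eq_bigr => k _; rewrite !mxE. Qed.

Lemma dotmx_ge0 k (u : 'rV[C]_k) : 0 <= dotmx u u.
Proof.
have [->|/dotmx_is_dotmx/ltW//] := eqVneq u 0.
by rewrite dotmxE mul0mx mxE.
Qed.

(** For a row eigenvector [v], [z |v|^2 = |v A|^2] with [|v|^2 > 0]. *)
Lemma eigenvalue_mulmx_adjoint_ge0 z : eigenvalue (A *m A ^t*) z -> 0 <= z.
Proof.
case/eigenvalueP => v vE v0.
rewrite -(pmulr_lge0 _ (dotmx_is_dotmx v0)).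
have -> : z * dotmx v v = dotmx (v *m A) (v *m A).
  rewrite !dotmxE trmx_mul map_mxM mulmxA -[v *m A *m _]mulmxA vE.
  by rewrite -scalemxAl [RHS]mxE.
exact: dotmx_ge0.
Qed.

Lemma mulmx_adjoint_normal : A *m A ^t* \is normalmx.
Proof.
apply/hermitian_normalmx/is_hermitianmxP; rewrite expr0 scale1r.
rewrite trmx_mul map_mxM; congr (_ *m _).
by apply/matrixP => i j; rewrite !mxE; exact/esym/conjCK.
Qed.

(** The Gram matrix has the inner products of distinct rows off the diagonal and the squared lengths
    on it; the first row supplies [a]. *)
Lemma rows_orthogonal_equal_lengthP : (0 < m)%N ->
  (rows_pairwise_orthogonal A /\ rows_equal_length A) <->
  exists a, A *m A ^t* = a%:M.
Proof.
move=> m0; split=> [[orthA lenA]|[a Aa]].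
  pose i0 := Ordinal m0; exists (dotmx (row i0 A) (row i0 A)).
  apply/matrixP => i j; rewrite mulmx_adjoint_dotmx mxE.
  have [<-|/orthA->] := eqVneq i j; last by rewrite mulr0n.
  by rewrite mulr1n -[LHS]sqrtCK -[RHS]sqrtCK; congr (_ ^+ _); apply: lenA.
split=> i j; rewrite /length -!mulmx_adjoint_dotmx Aa !mxE.
  by move/negPf->; rewrite mulr0n.
by rewrite !eqxx.
Qed.

End Gram.

(** A normal matrix is unitarily similar to the diagonal matrix of its eigenvalues, and a conjugate
    of a scalar matrix is that same scalar matrix. *)
Lemma normalmx_one_eigenvalue (C : numClosedFieldType) (n : nat)
  (M : 'M[C]_n) (a : C) :
  M \is normalmx -> (forall z, eigenvalue M z -> z = a) -> M = a%:M.
Proof.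
move=> /orthomx_spectralP; set P := spectralmx M; set d := spectral_diag M.
move=> ME eigM; have Pu : P \in unitmx := spectral_unit M.
suff dE : diag_mx d = a%:M.
  by rewrite ME dE mul_mx_scalar -scalemxAl mulVmx// scalemx1.
apply/matrixP => i j; rewrite !mxE; congr (_ *+ _).
(* Row [i] of [P] is a left eigenvector for the [i]-th diagonal entry; were it zero, the identity
   [P B = 1] would have a zero row. *)
apply: eigM; apply/eigenvalueP; exists (row i P); last first.
  apply: contraTneq Pu => Pi0; rewrite -row_free_unit.
  apply/negP => /row_freeP[B PB]; have := congr1 (row i) PB.
  rewrite row_mul Pi0 mul0mx => /rowP/(_ i); rewrite !mxE eqxx => /eqP.
  by rewrite eq_sym oner_eq0.
by rewrite -row_mul ME !mulmxA mulmxV// mul1mx row_mul row_diag_mx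
  -scalemxAl -rowE.
Qed.

Section SingularValues.
Variables (R : realType) (m n : nat) (A : 'M[R[i]]_(m, n)).

Lemma singular_value_ge0 i : 0 <= singular_value A i.
Proof.
have : all (fun s : R => 0 <= s) (singular_values A).
  by rewrite all_sort all_map; apply/allP => z _ /=; exact: sqrtr_ge0.
have [lt_i|ge_i] := ltnP i (size (singular_values A)).
  by move/all_nthP; apply.
by rewrite /singular_value nth_default.
Qed.

(** Constancy of a list depends neither on order nor on multiplicities. *)
Lemma singular_value_constP c :
  (forall i : 'I_m, singular_value A i = c) <->
  (forall z, eigenvalue (A *m A ^t*) z -> Num.sqrt (complex.Re z) = c).
Proof.
have size_sv : size (singular_values A) = m.
  by rewrite size_sort size_map size_eigenvalues.
have -> : (forall i : 'I_m, singular_value A i = c) <->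
    all (pred1 c) (singular_values A).
  split=> [svc|/all_nthP svc i]; last by apply/eqP/svc; rewrite size_sv.
  apply/(all_nthP 0) => i; rewrite size_sv => lt_i.
  exact/eqP/(svc (Ordinal lt_i)).
rewrite all_sort all_map; split=> [/allP svc z|svc].
  by rewrite -mem_eigenvalues => /svc/eqP.
by apply/allP => z; rewrite mem_eigenvalues => /svc/eqP.
Qed.

Lemma singular_values_const_scalarP :
  (exists c, forall i : 'I_m, singular_value A i = c) <->
  (exists a, A *m A ^t* = a%:M).
Proof.
split=> [[c /singular_value_constP svc]|[a Aa]].
  exists (c ^+ 2)%:C; apply: normalmx_one_eigenvalue.
    exact: mulmx_adjoint_normal.
  (* In [R[i]], [0 <= z] forces a zero imaginary part, so [z] is its real part, the square of
     [c]. *)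
  move=> z zE; have := eigenvalue_mulmx_adjoint_ge0 zE.
  rewrite -(svc z zE) lecE /= => /andP[/eqP Im0 Re0].
  by rewrite sqr_sqrtr// [LHS]complexE Im0 mulr0 addr0.
exists (Num.sqrt (complex.Re a)); apply/singular_value_constP => z.
rewrite Aa => /eigenvalueP[v]; rewrite mul_mx_scalar => /eqP.
by rewrite -subr_eq0 -scalerBl scaler_eq0 subr_eq0 => /orP[/eqP->//|->].
Qed.

(** The factor [m ^ (-1/p)] enters the root as [1/m], which leaves a power mean. *)
Lemma normalized_schatten p : 0 < p ->
  m%:R `^ (- p^-1) * schatten p A =
  (m%:R^-1 * \sum_(i < m) singular_value A i `^ p) `^ p^-1.
Proof.
move=> p0; rewrite powRM ?invr_ge0 ?ler0n//; last first.
  by apply: sumr_ge0 => i _; exact: powR_ge0.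
by rewrite -[m%:R^-1]powR_inv1 ?ler0n// -powRrM mulN1r.
Qed.

End SingularValues.

Theorem theorem17 (R : realType) (m n : nat) (hm : (1 <= m)%N)
  (hmn : (m <= n)%N) (A : 'M[R[i]]_(m, n)) (p q : R)
  (hp : 1 <= p) (hpq : p <= q) :
  m%:R `^ (- p^-1) * schatten p A <= m%:R `^ (- q^-1) * schatten q A /\
  (p < q ->
   (m%:R `^ (- p^-1) * schatten p A = m%:R `^ (- q^-1) * schatten q A <->
    rows_pairwise_orthogonal A /\ rows_equal_length A)).
Proof.
have p0 : 0 < p by exact: lt_le_trans hp.
have q0 : 0 < q by exact: lt_le_trans hpq.
have x0 (i : 'I_m) : 0 <= singular_value A i `^ p by exact: powR_ge0.
have mean0 r : 0 <= m%:R^-1 * \sum_(i < m) singular_value A i `^ r.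
  by rewrite mulr_ge0 ?invr_ge0 ?ler0n ?sumr_ge0// => i _; exact: powR_ge0.
have pow_q : \sum_(i < m) singular_value A i `^ q =
    \sum_(i < m) (singular_value A i `^ p) `^ (q / p).
  by apply: eq_bigr => i _; rewrite -powRrM mulrCA mulfV ?mulr1 ?gt_eqF.
(* With both sides written as [1/q]-th powers, monotonicity of that root gives the inequality and
   its injectivity the equality case. *)
have root_p (M : R) : M `^ p^-1 = (M `^ (q / p)) `^ q^-1.
  by rewrite -powRrM mulrAC mulfV ?mul1r ?gt_eqF.
rewrite !normalized_schatten//; split=> [|lt_pq].
  rewrite root_p pow_q ge0_ler_powR ?invr_ge0 ?(ltW q0)//.
  - by rewrite nnegrE powR_ge0.
  - by rewrite nnegrE -pow_q.
  - by apply: powR_mean_le; rewrite // ler_pdivlMr// mul1r.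
rewrite rows_orthogonal_equal_lengthP// -singular_values_const_scalarP.
split=> [|[c svc]].
  rewrite root_p pow_q => meanE.
  have svM (i : 'I_m) : singular_value A i `^ p =
      m%:R^-1 * \sum_(i < m) singular_value A i `^ p.
    apply: (powR_mean_eq hm x0 (r := q / p)); first by rewrite ltr_pdivlMr ?mul1r.
    by apply: powR_injective meanE; rewrite ?invr_gt0 ?nnegrE ?powR_ge0 -?pow_q.
  exists ((m%:R^-1 * \sum_(i < m) singular_value A i `^ p) `^ p^-1) => i.
  rewrite -(svM i).
  by rewrite -powRrM mulfV ?powRr1 ?singular_value_ge0 ?gt_eqF.
have c0 : 0 <= c by rewrite -(svc (Ordinal hm)) singular_value_ge0.
(* Conversely, every power mean of [m > 0] copies of [c] is [c]. *)
have mean_c r : 0 < r ->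
    (m%:R^-1 * \sum_(i < m) singular_value A i `^ r) `^ r^-1 = c.
  move=> r0; under eq_bigr do rewrite svc.
  rewrite sumr_const card_ord -[c `^ r *+ m]mulr_natl mulrA mulVf ?mul1r.
    by rewrite -powRrM mulfV ?powRr1 ?gt_eqF.
  by rewrite pnatr_eq0 -lt0n.
by rewrite !mean_c.
Qed.
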